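(* Let $\Omega$ be an arbitrary algebraic language and let $\mathbf{V}$ be a nontrivial variety of $\Omega$-algebras. Let $\mathbf{C}$ be the category whose objects are the ordered finite algebras $(A, \Omega^A, <)$ where $(A, \Omega^A)$ is a finite algebra in $\mathbf{V}$ and $<$ is a linear ordering of $A$, and whose morphisms are the rigid epimorphisms. Then $\mathbf{C}$ has the dual Ramsey property.
   Context: An algebraic language $\Omega$ is a set of constant and functional symbols (each with a finite arity). An $\Omega$-algebra $(A,\Omega^A)$ is a nonempty set $A$ with an operation $f^A$ of the appropriate arity for each $f\in\Omega$. A class $\mathbf{V}$ of $\Omega$-algebras is a variety if it is the class of all $\Omega$-algebras satisfying some set of identities $t_1\approx t_2$ between $\Omega$-terms; it is nontrivial if it contains an algebra with at least two elements. No compatibility between the linear order and the operations of an ordered algebra is required. For well-ordered chains $(A,<)$ and $(B,<)$ (in particular, finite linearly ordered sets), a surjective map $f:A\to B$ is a rigid surjection if $b_1<b_2$ implies $\min f^{-1}(b_1)<\min f^{-1}(b_2)$ for all $b_1,b_2\in B$. A rigid epimorphism $(A,\Omega^A,<)\to(B,\Omega^B,<)$ is a map that is an epimorphism (surjective homomorphism) $(A,\Omega^A)\to(B,\Omega^B)$ and at the same time a rigid surjection $(A,<)\to(B,<)$. A locally small category $\mathbf{C}$ has the dual Ramsey property if for every integer $k\ge 2$ and all objects $\mathcal{A},\mathcal{B}$ of $\mathbf{C}$ there is an object $\mathcal{C}$ of $\mathbf{C}$ such that for every coloring $\chi:\hom_{\mathbf{C}}(\mathcal{C},\mathcal{A})\to\{0,\dots,k-1\}$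 there is a morphism $w\in\hom_{\mathbf{C}}(\mathcal{C},\mathcal{B})$ with $|\chi(\hom_{\mathbf{C}}(\mathcal{B},\mathcal{A})\cdot w)|\le 1$, where $\hom_{\mathbf{C}}(\mathcal{B},\mathcal{A})\cdot w=\{f\cdot w: f\in\hom_{\mathbf{C}}(\mathcal{B},\mathcal{A})\}$. *)

(* Defs.v *)
From mathcomp Require Import all_boot all_order.
From mathcomp Require Import boolp classical_sets functions cardinality.

Set Implicit Arguments.
Unset Strict Implicit.
Unset Printing Implicit Defensive.

Import Order.TTheory.

Local Open Scope order_scope.
Local Open Scope classical_set_scope.
Local Open Scope card_scope.

(* [compm f g] is f . g, i.e., g followed by f. *)
Record category := Category {
  obj : Type;
  hom : obj -> obj -> Type;
  idm : forall A, hom A A;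
  compm : forall A B C, hom B C -> hom A B -> hom A C;
  comp1m : forall A B (f : hom A B), compm (idm B) f = f;
  compm1 : forall A B (f : hom A B), compm f (idm A) = f;
  compmA : forall A B C D (f : hom C D) (g : hom B C) (h : hom A B),
    compm f (compm g h) = compm (compm f g) h }.

Arguments compm {c A B C}.

(* [X #<= `I_1] says that the set X has at most one element. *)
Definition dual_Ramsey (C : category) : Prop :=
  forall (k : nat) (A B : obj C), (2 <= k)%N ->
  exists Z : obj C, forall chi : hom Z A -> 'I_k,
  exists w : hom Z B,
    chi @` [set compm f w | f in [set: hom B A]] #<= `I_1.

Record language := Language {
  symbol :> Type;
  arity : symbol -> nat }.

(* Constants are the symbols of arity 0. *)
Definition operations (L : language) (T : Type) :=
  forall s : L, {ffun 'I_(arity s) -> T} -> T.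

Record algebra (L : language) := Algebra {
  carrier :> Type;
  op : operations L carrier;
  carrier_nonempty : inhabited carrier }.

Inductive term (L : language) :=
| Var of nat
| App (s : L) of {ffun 'I_(arity s) -> term L}.

Fixpoint eval (L : language) (A : algebra L) (v : nat -> A) (t : term L) : A :=
  match t with
  | Var n => v n
  | App s args => op [ffun i => eval v (args i)]
  end.

Definition satisfies (L : language) (A : algebra L) (e : term L * term L) :=
  forall v : nat -> A, eval v e.1 = eval v e.2.

(* Classes of algebras are bare predicates, as [set (algebra L)] would be
   universe-inconsistent with the order structures used on algebras below. *)
Definition is_variety (L : language) (V : algebra L -> Prop) :=
  exists E : set (term L * term L),
    forall A, V A <-> forall e, E e -> satisfies A e.

Definition nontrivial (L : language) (V : algebra L -> Prop) :=
  exists2 A, V A & exists x y : A, x <> y.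

Definition homomorphism (L : language) (S T : Type)
    (opS : operations L S) (opT : operations L T) (f : S -> T) :=
  forall (s : L) (x : {ffun 'I_(arity s) -> S}),
    f (opS s x) = opT s [ffun i => f (x i)].

Definition surjection (S T : Type) (f : S -> T) := forall y, exists x, f x = y.

(* A [finTBOrderType] is exactly a nonempty finite linear order. *)

(* The default value \top of the empty minimum is never reached in
   [rigid_surjection]: all the fibres of a surjection are nonempty. *)
Definition fibre_min d d' (S : finTBOrderType d) (T : finTBOrderType d')
    (f : S -> T) (y : T) : S := \big[Order.min / \top]_(x | f x == y) x.

Definition rigid_surjection d d' (S : finTBOrderType d)
    (T : finTBOrderType d') (f : S -> T) :=
  surjection f /\
  forall y1 y2 : T, y1 < y2 -> fibre_min f y1 < fibre_min f y2.

Section FibreMin.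
Variables (d d' : Order.disp_t).
Variables (S : finTBOrderType d) (T : finTBOrderType d').
Implicit Type f : S -> T.

Lemma fibre_min_le f x : fibre_min f (f x) <= x.
Proof. exact: bigmin_le_cond. Qed.

Lemma fibre_minP f y : surjection f -> f (fibre_min f y) = y.
Proof.
move=> /(_ y)[x fx]; rewrite /fibre_min.
have Px : f x == y by apply/eqP.
rewrite (bigmin_eq_arg _ x) //; try (by move=> z _; exact: lex1).
by case: arg_minP => // z /eqP.
Qed.

Lemma fibre_min_unique f x y :
  surjection f -> f x = y -> (forall x', f x' = y -> x <= x') ->
  fibre_min f y = x.
Proof.
move=> f_surj fx xmin; apply/eqP; rewrite eq_le -{1}fx fibre_min_le /=.
exact/xmin/fibre_minP.
Qed.

End FibreMin.

Lemma rigid_surjection_id d (S : finTBOrderType d) :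
  rigid_surjection (@idfun S).
Proof.
have idsurj : surjection (@idfun S) by move=> x; exists x.
split=> // x y ltxy.
by rewrite !(@fibre_min_unique _ _ _ _ idfun _ _ idsurj erefl) // => z /= ->.
Qed.

Lemma rigid_surjection_comp d d' d'' (S : finTBOrderType d)
    (T : finTBOrderType d') (U : finTBOrderType d'')
    (g : T -> U) (f : S -> T) :
  rigid_surjection g -> rigid_surjection f -> rigid_surjection (g \o f).
Proof.
move=> [g_surj g_rigid] [f_surj f_rigid].
have gf_surj : surjection (g \o f).
  by move=> z; have [y <-] := g_surj z; have [x <-] := f_surj y; exists x.
split=> // z1 z2 ltz.
suff minE z : fibre_min (g \o f) z = fibre_min f (fibre_min g z).
  by rewrite !minE; apply/f_rigid/g_rigid.
apply: fibre_min_unique => //= [|x gfx]; first by rewrite !fibre_minP.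
have := fibre_min_le g (f x); rewrite gfx le_eqVlt => /predU1P[-> | /f_rigid].
  exact: fibre_min_le.
by move=> /ltW /le_trans; apply; exact: fibre_min_le.
Qed.

Section OrderedFiniteAlgebras.
Variables (L : language) (V : algebra L -> Prop).

(* Finite algebra in V with an arbitrary linear order on its carrier; the
   display is only MathComp's printing tag for the order. *)
Record ordered_algebra := OrderedAlgebra {
  oa_disp : Order.disp_t;
  oa_chain :> finTBOrderType oa_disp;
  oa_op : operations L oa_chain;
  oa_in : V (Algebra oa_op (inhabits \bot)) }.

Definition rigid_epimorphism (A B : ordered_algebra) (f : A -> B) :=
  homomorphism (@oa_op A) (@oa_op B) f /\ rigid_surjection f.

Definition rigid_hom (A B : ordered_algebra) := {f : A -> B | rigid_epimorphism f}.

Lemma rigid_epimorphism_id (A : ordered_algebra) :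
  rigid_epimorphism (idfun : A -> A).
Proof.
split; last exact: rigid_surjection_id.
by move=> s x; congr oa_op; apply/ffunP => i; rewrite ffunE.
Qed.

Lemma rigid_epimorphism_comp (A B C : ordered_algebra)
    (g : B -> C) (f : A -> B) :
  rigid_epimorphism g -> rigid_epimorphism f -> rigid_epimorphism (g \o f).
Proof.
move=> [g_hom g_rigid] [f_hom f_rigid]; split.
  move=> s x /=; rewrite f_hom g_hom.
  by congr oa_op; apply/ffunP => i; rewrite !ffunE.
exact: rigid_surjection_comp.
Qed.

Definition rigid_id (A : ordered_algebra) : rigid_hom A A := exist _ _ (rigid_epimorphism_id A).

Definition rigid_comp (A B C : ordered_algebra)
    (g : rigid_hom B C) (f : rigid_hom A B) : rigid_hom A C :=
  exist _ _ (rigid_epimorphism_comp (svalP g) (svalP f)).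

Lemma rigid_hom_inj (A B : ordered_algebra) (f g : rigid_hom A B) :
  sval f = sval g -> f = g.
Proof.
by case: f g => [f Pf] [g Pg] /= eq_fg; apply: eq_exist.
Qed.

Lemma rigid_comp1m A B (f : rigid_hom A B) : rigid_comp (rigid_id B) f = f.
Proof. exact: rigid_hom_inj. Qed.

Lemma rigid_compm1 A B (f : rigid_hom A B) : rigid_comp f (rigid_id A) = f.
Proof. exact: rigid_hom_inj. Qed.

Lemma rigid_compA A B C D
    (f : rigid_hom C D) (g : rigid_hom B C) (h : rigid_hom A B) :
  rigid_comp f (rigid_comp g h) = rigid_comp (rigid_comp f g) h.
Proof. exact: rigid_hom_inj. Qed.

Definition ordered_finite_algebras : category :=
  Category rigid_comp1m rigid_compm1 rigid_compA.

End OrderedFiniteAlgebras.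

(* Main.v *)
From HB Require Import structures.
Require Import Defs.
From mathcomp Require Import all_boot all_order.
From mathcomp Require Import boolp classical_sets functions cardinality.
From mathcomp Require Import zify.

(** The theorem combines the dual Ramsey theorem of Graham and Rothschild for
    finite chains with the extension property of free algebras, of which finite
    approximations suffice.

    Algebra. Let X be a finite chain. If Z is a finite ordered algebra in the
    variety that contains X as an initial segment, and if every map from X to A
    or to B extends to a homomorphism on Z, then the extension of a rigid
    surjection is a rigid epimorphism: every fibre meets X, and has its minimum
    there ([rigid_extension]). When these extensions are compatible with the
    homomorphisms B -> A, a colouring of hom(Z, A) restricts to a colouring of
    the rigid surjections X -> A, and a rigid surjection X -> B that is good
    for the latter extends to a morphism Z -> B that is good for the former. A
    finite Z of this kind exists in every variety ([free_ordered_algebra]): in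
    the product of two powers A^(A^X) and B^(B^X), take the pairs (p, q) such
    that f (q w) = p (f o w) for all homomorphisms f : B -> A and all maps w :
    X -> B. A point of X is identified with the pair of evaluations at it;
    these pairs differ from each other as soon as B has two elements. When B is
    a single point, there is at most one morphism B -> A, and Z = B works.

    Combinatorics. A rigid surjection between chains is a word in which the
    first occurrences of the letters 0, 1, 2... come in this order. For the
    induction, [pword a k] describes the words in which the letters below a
    are unrestricted, as in the parameter words of Graham and Rothschild. Then
    [graham_rothschild] is proved by induction on the number of parameters,
    for all alphabets at once. Without parameters it is the Hales-Jewett
    theorem, proved after Shelah by merging two letters at a time
    ([insensitive], [hales_jewett]). For the induction step, a parameter word
    is a prefix over the alphabet, the first parameter a, and then a parameter
    word with one parameter fewer over the alphabet enlarged by a. The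
    induction hypothesis makes the colour depend only on the prefix
    ([prefix_dependent]), and the Hales-Jewett theorem then makes it constant
    on the prefixes that matter ([prefix_homogeneous]). *)

Set Implicit Arguments.
Unset Strict Implicit.
Unset Printing Implicit Defensive.

Import Order.TTheory.

(** * Parameter words *)

(** The letters below [a] are constants and [a, ..., k - 1] are parameters, each
    of which occurs, with first occurrences in increasing order. Prefixed with
    [iota 0 a], such a word is a rigid surjection onto [k] that is the identity
    on its first [a] points. *)
Fixpoint pword (a k : nat) (s : seq nat) : bool :=
  if s is x :: s' then
    (x < a) && pword a k s' || (x == a) && pword a.+1 k s'
  else a == k.

Definition letter (a : nat) (f : seq nat) (x : nat) : nat :=
  if x < a then x else nth 0 f (x - a).

(** The substitution of [f] for the parameters of [g] is the composition of the
    two rigid surjections. *)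
Definition subst (a : nat) (f g : seq nat) : seq nat := map (letter a f) g.

Lemma size_subst a f g : size (subst a f g) = size g.
Proof. exact: size_map. Qed.

Lemma subst_cat a f g h : subst a f (g ++ h) = subst a f g ++ subst a f h.
Proof. exact: map_cat. Qed.

Lemma subst_comp a f g h :
  0 < a -> subst a f (subst a g h) = subst a (subst a f g) h.
Proof.
move=> a_gt0; rewrite /subst -map_comp; apply: eq_map => x /=.
rewrite [letter a g x]/letter [RHS]/letter; case: (ltnP x a) => [ltxa | leax].
  by rewrite /letter ltxa.
have [ltg | leg] := ltnP (x - a) (size g); first by rewrite (nth_map 0).
by rewrite !nth_default ?size_map // /letter a_gt0.
Qed.

Lemma pword_leq a k s : pword a k s -> a <= k.
Proof.
elim: s a => [|x s IHs] a /=; first by move/eqP->.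
by case/orP=> /andP[_ /IHs] // /ltnW.
Qed.

Lemma pword_ltn a k s : pword a k s -> all (gtn k) s.
Proof.
elim: s a => //= x s IHs a.
by case/orP=> /andP[xa ks]; rewrite (IHs _ ks) andbT /=; have := pword_leq ks; lia.
Qed.

Lemma pword_const a s : pword a a s = all (gtn a) s.
Proof.
elim: s => [|x s IHs] /=; first exact: eqxx.
rewrite IHs; case E: (pword a.+1 a s); last by rewrite andbF orbF.
by have := pword_leq E; rewrite ltnn.
Qed.

Lemma pword_cat a j k p q :
  pword a j p -> pword a k (p ++ q) = pword j k q.
Proof.
elim: p a => [|x p IHp] a /=; first by move/eqP->.
case/orP=> /andP[xa jp]; rewrite (IHp _ jp) xa /=.
  by rewrite (ltn_eqF xa) orbF.
by rewrite (eqP xa) ltnn.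
Qed.

(** A parameter word can be cut at the first occurrence of any parameter [y]:
    earlier parameters are introduced before it, later ones after it. *)
Lemma pword_split a k y s :
    pword a k s -> a <= y < k ->
  exists p q, [/\ s = p ++ y :: q, pword a y p & pword y.+1 k q].
Proof.
elim: s a => [|x s IHs] a /=; first by move/eqP->; lia.
case/orP=> /andP[xa ks] yk.
  have [p [q [-> yp kq]]] := IHs _ ks yk.
  by exists (x :: p), q; rewrite /= xa yp.
have [-> | neq] := eqVneq y a.
  by exists [::], s; rewrite (eqP xa) /= eqxx.
have [|p [q [-> yp kq]]] := IHs _ ks; first by lia.
by exists (x :: p), q; rewrite /= xa yp orbT.
Qed.

(** Composites of rigid surjections are rigid. The induction on [g] follows two
    alphabets: [j] letters of [g] are known so far, and their images, which are
    the first [j] letters of [iota 0 a ++ f], make up an alphabet of [i] letters. *)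
Lemma pword_subst a m k f g :
  pword a m g -> pword a k f -> size f = m - a -> pword a k (subst a f g).
Proof.
move=> mg kf sz_f.
suff H j i : a <= j -> pword j m g -> pword a i (take (j - a) f) ->
    pword i k (subst a f g).
  by apply: H mg _; rewrite ?subnn ?take0 /=.
elim: {mg} g j i => [|x g IHg] j i leaj /=.
  move/eqP->; rewrite -sz_f take_size => ifa.
  by have := pword_cat k [::] ifa; rewrite cats0 kf.
case/orP=> /andP[xj mg] iF.
- rewrite (IHg _ _ leaj mg iF) andbT.
  suff lti : letter a f x < i by rewrite lti.
  rewrite /letter; case: (ltnP x a) => [ltxa | leax].
    exact: leq_trans ltxa (pword_leq iF).
  have lt_x : x - a < size (take (j - a) f).
    rewrite size_takel; first by lia.
    by rewrite sz_f leq_sub2r // (pword_leq mg).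
  have := all_nthP 0 (pword_ltn iF) _ lt_x.
  by rewrite nth_take //; lia.
- have eqx := eqP xj; subst x.
  have ltj : j - a < size f by rewrite sz_f; have := pword_leq mg; lia.
  have letj : letter a f j = nth 0 f (j - a) by rewrite /letter ltnNge leaj.
  have step i' : pword a i' (take (j - a).+1 f) -> pword i' k (subst a f g).
    by rewrite -subSn // => /(IHg j.+1); apply; [lia | exact: mg].
  rewrite letj.
  have: pword a k (take (j - a).+1 f ++ drop (j - a).+1 f) by rewrite cat_take_drop.
  rewrite (take_nth 0) // -cats1 -catA /= (pword_cat _ _ iF) /=.
  move=> /orP[] /andP[xi _]; rewrite xi.
  - by rewrite step // (take_nth 0) // -cats1 (pword_cat _ _ iF) /= xi eqxx.
  - rewrite (step i.+1) ?orbT // (take_nth 0) // -cats1 (pword_cat _ _ iF) /=.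
    by rewrite xi eqxx orbT.
Qed.

(** Moves the parameters up by one, so that [a] can be put in front of the word
    as a new first parameter. *)
Definition shift (a x : nat) : nat := if x < a then x else x.+1.

Lemma pword_shift a j k s :
  a <= j -> pword j k s -> pword j.+1 k.+1 (map (shift a) s).
Proof.
elim: s j => [|x s IHs] j leaj /=; first by rewrite eqSS.
case/orP=> /andP[xj ks].
  have -> : shift a x < j.+1 by rewrite /shift; case: ifP => _; lia.
  by rewrite IHs.
have -> : shift a x = j.+1 by rewrite (eqP xj) /shift ltnNge leaj.
by rewrite (IHs j.+1) ?eqxx ?orbT // leqW.
Qed.

Lemma subst_shift a x w g :
  subst a (x :: w) (map (shift a) g) = subst a w g.
Proof.
rewrite /subst -map_comp; apply: eq_map => y /=; rewrite /letter /shift.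
by case: (ltnP y a) => [-> // | leay]; rewrite ltnNge leqW //= subSn.
Qed.

(** A word that keeps the first parameter of [v] treats it as one more constant;
    this is why the induction on the number of parameters enlarges the
    alphabet. *)
Lemma subst_cons a u v : subst a (a :: u) v = subst a.+1 u v.
Proof.
apply: eq_map => y; rewrite /letter ltnS.
have [lt|lt|->] := ltngtP y a => //; last by rewrite subnn.
by rewrite -[y - a]prednK ?subn_gt0 //= -subnS.
Qed.

(** * The Graham-Rothschild theorem *)

(** The Ramsey property of [d]-parameter words over [a] letters: [g] is an
    [e]-dimensional subspace, and [subst a f g] runs through its [d]-dimensional
    subspaces. *)
Definition ramsey_words (a d : nat) : Prop :=
  forall (K : finType) (e : nat), exists n, forall c : seq nat -> K,
  exists2 g, pword a (a + e) g && (size g == n) &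
  exists x, forall f, pword a (a + d) f -> size f = e -> c (subst a f g) = x.

(** Words of a given length form a finite type, so that a colouring of the
    continuations of a word is itself a colour. *)
Lemma wordP n b s :
  all (gtn b) s -> size s = n -> exists t : n.-tuple 'I_b, s = map val t.
Proof.
move=> bs sz; have sz' : size (pmap (insub : nat -> option 'I_b) s) == n.
  rewrite size_pmap -sz -all_count; apply: sub_all bs => x /= ltx.
  by rewrite insubT.
exists (Tuple sz') => /=; rewrite pmap_filter ?(all_filterP _) //.
  by apply: sub_all bs => x /= ltx; rewrite insubT.
exact: insubK.
Qed.

Definition merge (a x : nat) : nat := if x == a then 0 else x.

(** Shelah's insensitivity lemma: on some subspace, the colour does not change
    when the letter [a] is replaced by [0]. In dimension one, this is the
    pigeonhole principle applied to the words [0 ... 0 a ... a]: if two of them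
    have the same colour, then the places where they differ become the
    parameter. *)
Lemma insensitive a (K : finType) e :
  exists n, forall c : seq nat -> K,
  exists2 g, pword a.+1 (a.+1 + e) g && (size g == n) &
  forall w, all (gtn a.+1) w -> size w = e ->
    c (subst a.+1 w g) = c (subst a.+1 (map (merge a) w) g).
Proof.
elim: e K => [|e IHe] K.
  exists 0 => c; exists [::]; first by rewrite /= addn0 eqxx.
  by case.
have [n IHn] := IHe {ffun 'I_a.+1 -> K}.
(* A block of length [L] has [L.+1] values [P i], one more than there are
   colourings of its continuations. *)
pose L := #|{ffun n.-tuple 'I_a.+1 -> K}|.
exists (L + n) => c.
pose P i := nseq i 0 ++ nseq (L - i) a.
pose F (i : 'I_L.+1) := [ffun t : n.-tuple 'I_a.+1 => c (P i ++ map val t)].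
have [i [j [ltij eqF]]] : exists i j : 'I_L.+1, i < j /\ F i = F j.
  have /injectivePn[i [j neq eqF]] : ~~ injectiveb F.
    by apply/negP => /injectiveP/leq_card; rewrite card_ord ltnn.
  have [ltij|ltji|/val_inj eqij] := ltngtP i j; first by exists i, j.
    by exists j, i.
  by rewrite eqij eqxx in neq.
pose blk x := nseq i 0 ++ nseq (j - i) x ++ nseq (L - j) a.
have leij : i <= j <= L by have := ltn_ord j; lia.
have blk0 : blk 0 = P j.
  by rewrite /blk /P catA -nseqD subnKC //; lia.
have blka : blk a = P i.
  by rewrite /blk /P -nseqD; congr (_ ++ nseq _ _); lia.
have blk_merge x v : x <= a -> all (gtn a.+1) v -> size v = n ->
    c (blk x ++ v) = c (blk (merge a x) ++ v).
  rewrite /merge; case: eqP => // -> _ va sz_v.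
  have [t ->] := wordP va sz_v.
  by rewrite blk0 blka; have /ffunP/(_ t) := eqF; rewrite !ffunE.
have [g /andP[pg /eqP sz_g] gP] :=
  IHn (fun v => [ffun x : 'I_a.+1 => c (blk x ++ v)]).
exists (blk a.+1 ++ map (shift a.+1) g).
  rewrite !size_cat !size_nseq size_map sz_g; apply/andP; split; last by lia.
  have nconst b m x k s : x < b -> pword b k s -> pword b k (nseq m x ++ s).
    by move=> ltxb ks; elim: m => //= m ->; rewrite ltxb.
  rewrite -!catA; apply: (nconst) => //.
  have [m ->] : exists m, j - i = m.+1 by exists (j - i).-1; lia.
  rewrite /= ltnn eqxx /=.
  apply: (nconst); [lia|].
  apply: (nconst); [lia|].
  by rewrite addnS; apply: pword_shift.
case=> // x w /= /andP[ltx wa] [sz_w].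
have blkE y v : y <= a -> subst a.+1 (y :: v) (blk a.+1) = blk y.
  move=> leya; rewrite /blk /subst !map_cat !map_nseq /letter ltnn subnn /=.
  by rewrite ltnS leqnn.
have mxa : merge a x <= a by rewrite /merge; case: eqP => // _; lia.
rewrite !(subst_cat _ _ (blk _)) !blkE // !subst_shift.
have /ffunP/(_ (Ordinal ltx)) := gP _ wa sz_w; rewrite !ffunE /= => ->.
apply: blk_merge => //; last by rewrite size_subst.
rewrite -pword_const; apply: (pword_subst pg); last by rewrite size_map; lia.
rewrite pword_const all_map; apply: sub_all wa => y /=.
by rewrite /merge; case: eqP.
Qed.

(** On a subspace where the colour ignores the difference between the last
    letter and [0], the last letter may be dropped from the alphabet. *)
Lemma hales_jewett a : ramsey_words a.+1 0.
Proof.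
elim: a => [|a IHa] K e.
  exists e => c; exists (iota 1 e).
    rewrite size_iota eqxx andbT; elim: e 1 => [|e IHe] b /=.
      by rewrite addn0.
    by rewrite ltnn eqxx addnS -addSn IHe.
  exists (c (nseq e 0)) => f; rewrite addn0 pword_const => f0 sz_f; congr c.
  have {f0} -> : f = nseq e 0.
    rewrite -sz_f; elim: f f0 {sz_f} => //= x f IHf /andP[x0 /IHf <-].
    by congr (_ :: _); lia.
  apply: (@eq_from_nth _ 0); rewrite ?size_subst size_iota ?size_nseq //.
  move=> i lti; rewrite (nth_map 0) ?size_iota // nth_iota // /letter nth_nseq.
  by rewrite ltnNge /= !nth_nseq; do 2!case: ifP.
have [N HN] := IHa K e; have [n Hn] := insensitive a.+1 K N.
exists n => c; have [g /andP[pg /eqP sz_g] gP] := Hn c.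
have [h /andP[ph /eqP sz_h] [x hP]] := HN (fun v => c (subst a.+2 v g)).
have ph' : pword a.+2 (a.+2 + e) (map (shift a.+1) h) by exact: pword_shift.
exists (subst a.+2 (map (shift a.+1) h) g).
  rewrite size_subst sz_g eqxx andbT.
  by apply: (pword_subst pg) => //; rewrite size_map; lia.
exists x => w; rewrite addn0 pword_const => wa sz_w.
rewrite subst_comp // gP; last by rewrite size_subst size_map.
- rewrite -(hP (map (merge a.+1) w)) ?size_map //; last first.
    rewrite addn0 pword_const all_map; apply: sub_all wa => y /=.
    by rewrite /merge; case: eqP; lia.
  congr c; congr (subst _ _ _); rewrite /subst -!map_comp.
  apply: eq_map => y /=; rewrite /letter /shift.
  case: (ltnP y a.+1) => [ltya | leay].
    by rewrite leqW // /merge ltn_eqF.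
  rewrite ltnNge ltnS leay /= subSS.
  have [lty | ley] := ltnP (y - a.+1) (size w); first by rewrite (nth_map 0).
  by rewrite !nth_default ?size_map.
- rewrite -pword_const; apply: (pword_subst ph'); last by lia.
  by rewrite pword_const.
Qed.

(** Fusion. The first letter of the word to be substituted is either the first
    parameter, in which case the rest is a word with one parameter fewer over
    [a.+1] letters and the hypothesis makes the colour constant, or one of the
    [a] constants, and these cases are treated simultaneously by the induction
    on [e] for the product of [a] colourings. *)
Lemma prefix_dependent a d (K : finType) e :
    0 < a -> ramsey_words a.+1 d ->
  exists n, forall c : seq nat -> K,
  exists2 g, pword a (a + e) g && (size g == n) &
  exists C : seq nat -> K, forall w u,
    all (gtn a) w -> pword a.+1 (a.+1 + d) u -> size w + (size u).+1 = e ->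
    c (subst a (w ++ a :: u) g) = C w.
Proof.
move=> a_gt0 dp; elim: e K => [|e IHe] K.
  exists 0 => c; exists [::]; first by rewrite /= addn0 eqxx.
  by exists (fun=> c [::]).
have [n' Hn'] := IHe {ffun 'I_a -> K}; have [n Hn] := dp K n'.
exists n.+1 => c.
have [h /andP[ph /eqP sz_h] [x0 hP]] := Hn (fun u => c (a :: u)).
have [g /andP[pg /eqP sz_g] [C gP]] :=
  Hn' (fun f => [ffun x : 'I_a => c (subst a (val x :: f) (a :: h))]).
have pg' : pword a.+1 (a.+1 + e) (map (shift a) g) by exact: pword_shift.
exists (subst a (a :: map (shift a) g) (a :: h)).
  rewrite size_subst /= sz_h eqxx andbT.
  have pah : pword a (a.+1 + n') (a :: h) by rewrite /= eqxx ph orbT.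
  apply: (pword_subst pah); last by rewrite /= size_map; lia.
  by rewrite /= eqxx addnS -addSn pg' orbT.
(* The default colour for letters outside the alphabet is never reached. *)
exists (fun w => if w is x :: w' then
                   if insub x is Some i then C w' i else x0
                 else x0).
have letteraa f : letter a (a :: f) a = a by rewrite /letter ltnn subnn.
case=> [|x w] u /=.
  move=> _ pu; rewrite add0n => -[sz_u].
  rewrite -/(subst a _ _) letteraa subst_cons /= letteraa -/(subst a _ _).
  rewrite subst_cons subst_comp // hP ?size_subst ?size_map //.
  by apply: (pword_subst pg') => //; lia.
move=> /andP[ltxa wa] pu; rewrite addSn => -[sz_wu].
rewrite insubT /= -(gP w u) // ffunE /=; congr c.
have leta f : letter a (x :: f) a = x by rewrite /letter ltnn subnn.
rewrite leta letteraa leta; congr (_ :: _).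
rewrite -/(subst a _ _) -/(subst a _ h) subst_comp //=.
by rewrite leta -/(subst a _ _) subst_shift.
Qed.

(** Words of all lengths below [t x] are made monochromatic, for one colour [x].
    Starting from the longest words, the Hales-Jewett theorem finds a subspace
    whose words of maximal length have the same colour [x]; this lowers the
    target [t x] by one for what remains to be done on shorter words. The
    targets depend on the colour, with only their sum prescribed, which takes
    the place of a final pigeonhole argument. *)
Lemma prefix_homogeneous a (K : finType) N :
  0 < a ->
  exists n, forall (C : seq nat -> K) (t : K -> nat), \sum_x t x = N ->
  exists x, exists2 g, pword a (a + t x) g && (size g == n) &
  forall l, l < t x -> exists p q, [/\ g = p ++ (a + l) :: q, pword a (a + l) p &
    forall w, all (gtn a) w -> size w = l -> C (subst a w p) = x].
Proof.
move=> a_gt0; elim: N => [|N [n IHn]].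
  exists 0 => C t /eqP; rewrite sum_nat_eq0 => /forallP/(_ (C [::]))/= /eqP t0.
  exists (C [::]); exists [::]; first by rewrite t0 /= addn0 eqxx.
  by rewrite t0.
have [m Hm] := hales_jewett a.-1 K n; rewrite (prednK a_gt0) in Hm.
exists m.+1 => C t sum_t.
have [g1 /andP[pg1 /eqP sz_g1] [x g1P]] := Hm C.
have {}g1P w : all (gtn a) w -> size w = n -> C (subst a w g1) = x.
  by rewrite -pword_const => wa; apply: g1P; rewrite ?addn0.
have [tx0 | tx_gt0] := posnP (t x).
  exists x; exists (nseq m.+1 0); last by rewrite tx0.
  by rewrite size_nseq eqxx tx0 addn0 pword_const andbT; rewrite all_nseq /= a_gt0.
pose t' y := t y - (y == x).
(* A word [v] over the parameters of [g1] is coloured through the part of [g1]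
   before the next parameter, the only part that [v] determines. *)
have [|y [g2 /andP[pg2 /eqP sz_g2] g2P]] :=
    IHn (fun v => C (subst a v (take (index (a + size v) g1) g1))) t'.
  move: sum_t; rewrite (bigD1 x) //= => sum_t; rewrite (bigD1 x) //= {1}/t' eqxx.
  rewrite (eq_bigr t) /=; first by lia.
  by move=> z /negbTE nzx; rewrite /t' nzx subn0.
have pG : pword a (a + t' y) (subst a g2 g1).
  by apply: (pword_subst pg1) => //; lia.
have GP l : l < t' y ->
    exists p q, [/\ subst a g2 g1 = p ++ (a + l) :: q, pword a (a + l) p &
    forall w, all (gtn a) w -> size w = l -> C (subst a w p) = y].
  move=> ltl; have [p2 [q2 [g2E pp2 p2P]]] := g2P l ltl.
  have lti : size p2 < n by rewrite -sz_g2 g2E size_cat /=; lia.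
  have [|p1 [q1 [g1E pp1 _]]] := pword_split (y := a + size p2) pg1.
    by lia.
  have sub_p1 : subst a g2 p1 = subst a p2 p1.
    apply/eq_in_map => z zp1; rewrite /letter; case: ltnP => // leaz.
    have := allP (pword_ltn pp1) _ zp1; rewrite /= => ltz.
    by rewrite g2E nth_cat ifT //; lia.
  exists (subst a p2 p1), (subst a g2 q1); split.
  - rewrite g1E subst_cat /= sub_p1; congr (_ ++ _ :: _).
    rewrite /letter ltnNge leq_addr /= addKn g2E nth_cat ltnn subnn //.
  - by apply: (pword_subst pp1) => //; lia.
  - move=> w wa sz_w; rewrite -(p2P w wa sz_w) size_subst g1E.
    rewrite index_cat /= eqxx addn0.
    have /negbTE-> : a + size p2 \notin p1.
      by apply/negP => /(allP (pword_ltn pp1)) /=; rewrite ltnn.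
    by rewrite take_size_cat // subst_comp.
(* If [x] is also the colour of the shorter words, then those of maximal length
   are added to them by means of a final parameter; otherwise any final letter
   does. *)
have [eqyx | neqyx] := eqVneq y x.
  have txE : t x = (t' x).+1 by rewrite /t' eqxx; lia.
  rewrite eqyx in pG GP; exists x; exists (rcons (subst a g2 g1) (a + t' x)).
    rewrite size_rcons size_subst sz_g1 eqxx andbT -cats1 (pword_cat _ _ pG) /=.
    by rewrite eqxx txE addnS eqxx orbT.
  move=> l; rewrite txE ltnS leq_eqVlt => /predU1P[->|/GP].
    exists (subst a g2 g1), [::]; rewrite cats1; split=> // w wa sz_w.
    rewrite subst_comp //; apply: g1P; last by rewrite size_subst.
    rewrite -pword_const; apply: (pword_subst pg2); last by rewrite sz_w eqyx; lia.
    by rewrite pword_const.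
  case=> p [q [-> pp pP]]; exists p, (rcons q (a + t' x)); split=> //.
  by rewrite -rcons_cons -rcons_cat.
have tyE : t' y = t y by rewrite /t' (negbTE neqyx) subn0.
rewrite tyE in pG GP; exists y; exists (rcons (subst a g2 g1) 0).
  rewrite size_rcons size_subst sz_g1 eqxx andbT -cats1 (pword_cat _ _ pG) /=.
  by rewrite eqxx andbT; lia.
move=> l /GP[p [q [-> pp pP]]]; exists p, (rcons q 0); split=> //.
by rewrite -rcons_cons -rcons_cat.
Qed.

Theorem graham_rothschild a d : 0 < a -> ramsey_words a d.
Proof.
elim: d a => [|d IHd] a a_gt0 K e.
  by rewrite -(prednK a_gt0); apply: hales_jewett.
have [m Hm] := prefix_homogeneous K (\sum_(x : K) e) a_gt0.
have [n Hn] := prefix_dependent K m a_gt0 (IHd a.+1 isT).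
exists n => c; have [g /andP[pg /eqP sz_g] [C gP]] := Hn c.
have [x [h /andP[ph /eqP sz_h] hP]] := Hm C (fun=> e) erefl.
have szh_m : size h = (a + m) - a by lia.
exists (subst a h g).
  by rewrite size_subst sz_g eqxx andbT; apply: (pword_subst pg).
exists x => f pf sz_f.
have [|w [u [fE pw pu]]] := pword_split (y := a) pf; first by lia.
have [|p [q [hE pp pP]]] := hP (size w).
  by rewrite -sz_f fE size_cat /=; lia.
have pfh : pword a (a + d.+1) (subst a f h) by apply: (pword_subst ph) => //; lia.
have fhE : subst a f h = subst a w p ++ a :: subst a f q.
  rewrite hE subst_cat /=; congr (_ ++ _ :: _); last first.
    by rewrite /letter ltnNge leq_addr /= addKn fE nth_cat ltnn subnn.
  apply/eq_in_map => z zp; rewrite /letter; case: ltnP => // leaz.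
  have := allP (pword_ltn pp) _ zp; rewrite /= => ltz.
  by rewrite fE nth_cat ifT //; lia.
have pwp : pword a a (subst a w p) by apply: (pword_subst pp) => //; lia.
rewrite subst_comp // fhE gP -?pword_const //.
- by apply: pP => //; rewrite -pword_const.
- by move: pfh; rewrite fhE (pword_cat _ _ pwp) /= ltnn eqxx addnS -addSn.
- rewrite -sz_h -(size_subst a f h) fhE size_cat //.
Qed.

(** * Rigid surjections as words *)

Lemma pword_mem k s y : pword 0 k s -> y < k -> y \in s.
Proof.
move=> ps ltyk; have [|p [q [-> _ _]]] := pword_split (y := y) ps => //.
by rewrite mem_cat mem_head orbT.
Qed.

Lemma pword_index k s x y :
  pword 0 k s -> x < y < k -> index x s < index y s.
Proof.
move=> ps /andP[ltxy ltyk].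
have [|p [q [-> py _]]] := pword_split (y := y) ps => //.
have yNp : y \notin p by apply/negP => /(allP (pword_ltn py)) /=; rewrite ltnn.
rewrite !index_cat (negbTE yNp) (pword_mem py ltxy) /= eqxx addn0.
by rewrite index_mem (pword_mem py ltxy).
Qed.

(** Together with [pword_mem] and [pword_index], this identifies parameter words
    by the order of first occurrences, which is how rigidity is defined. *)
Lemma pword_of_index a k s :
    a <= k -> all (gtn k) s -> (forall y, a <= y < k -> y \in s) ->
    (forall x y, a <= x -> x < y < k -> index x s < index y s) ->
  pword a k s.
Proof.
elim: s a => [|x s IHs] a leak /=.
  move=> _ mems _; rewrite eqn_leq leak leqNgt; apply/negP => ltak.
  by have := mems a; rewrite leqnn ltak => /(_ isT).
move=> /andP[ltxk ks] mems idx.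
have [ltxa | ltax | eqxa] := ltngtP x a; rewrite /=.
- rewrite orbF; apply: IHs => // [y ayk | y z leay yzk].
    by have := mems y ayk; rewrite inE => /predU1P[] //; lia.
  by have := idx y z leay yzk; rewrite !ifF //; apply/eqP; lia.
- have := idx a x (leqnn a); rewrite ltax eqxx => /(_ ltxk).
  by case: eqP => //; lia.
- subst x; apply: IHs => // [y ayk | y z leay yzk].
    by have := mems y; rewrite inE => /(_ _)/predU1P[] //; lia.
  by have := idx y z (ltnW leay) yzk; rewrite !ifF //; apply/eqP; lia.
Qed.

Section Rank.
Variables (d : Order.disp_t) (T : finTBOrderType d).

Definition rank (x : T) : nat := Order.enum_rank x.
Definition unrank (i : nat) : T := nth \bot%O (Order.enum T) i.

Lemma rank_ltn x : rank x < #|T|.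
Proof. exact: ltn_ord. Qed.

Lemma rankK x : unrank (rank x) = x.
Proof. exact: Order.nth_enum_rank. Qed.

Lemma unrankK i : i < #|T| -> rank (unrank i) = i.
Proof.
move=> lti; rewrite /unrank -(Order.enum_val_nth \bot%O (Ordinal lti)).
by rewrite /rank Order.enum_valK.
Qed.

Lemma lt_rank x y : (rank x < rank y) = (x < y)%O.
Proof.
rewrite ltnNge ltNge; congr negb.
exact: (Order.le_enum_rank (@le_total _ T)).
Qed.

Lemma rank_inj : injective rank.
Proof. exact: can_inj rankK. Qed.
End Rank.

Section RigidWords.
Variables (d d' : Order.disp_t).
Variables (S : finTBOrderType d) (T : finTBOrderType d').

Definition word (f : S -> T) : seq nat :=
  mkseq (fun i => rank (f (unrank S i))) #|S|.

Definition unword (s : seq nat) (x : S) : T := unrank T (nth 0 s (rank x)).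

Lemma size_word f : size (word f) = #|S|.
Proof. exact: size_mkseq. Qed.

Lemma nth_word f i : i < #|S| -> nth 0 (word f) i = rank (f (unrank S i)).
Proof. exact: nth_mkseq. Qed.

(** First occurrences in the word are minima of fibres. *)
Lemma index_word f y :
  surjection f -> index (rank y) (word f) = rank (fibre_min f y).
Proof.
move=> f_surj; have fy := fibre_minP y f_surj.
set m := fibre_min f y; have ltm := rank_ltn m.
have nth_m : nth 0 (word f) (rank m) = rank y by rewrite nth_word // rankK fy.
have ltidx : index (rank y) (word f) < #|S|.
  by rewrite -(size_word f) index_mem -nth_m mem_nth // size_word.
apply/eqP; rewrite eqn_leq; apply/andP; split; rewrite leqNgt.
  by apply/negP => /(before_find 0)/=; rewrite nth_m eqxx.
rewrite -(unrankK ltidx) lt_rank -leNgt.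
set x := unrank _ _.
have fx : f x = y.
  apply: rank_inj; rewrite -nth_word // nth_index //.
  by rewrite -index_mem size_word.
by rewrite /m -fx fibre_min_le.
Qed.

Lemma pword_word f : rigid_surjection f -> pword 0 #|T| (word f).
Proof.
move=> [f_surj f_rigid]; apply: pword_of_index => // [|y ltyT|x y _].
- by apply/allP => _ /mapP[i _ ->] /=; apply: rank_ltn.
- rewrite -index_mem size_word -(unrankK ltyT) index_word //.
  exact: rank_ltn.
- move=> /andP[ltxy ltyT]; have ltxT := ltn_trans ltxy ltyT.
  rewrite -(unrankK ltxT) -(unrankK ltyT) !index_word // lt_rank.
  by apply: f_rigid; rewrite -lt_rank !unrankK.
Qed.

Lemma unword_rigid s :
  pword 0 #|T| s -> size s = #|S| -> rigid_surjection (unword s).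
Proof.
move=> ps sz_s.
have lt_idx (y : T) : index (rank y) s < #|S|.
  by rewrite -sz_s index_mem; apply: (pword_mem ps); exact: rank_ltn.
have unword_idx y : unword s (unrank S (index (rank y) s)) = y.
  rewrite /unword unrankK // nth_index ?rankK //.
  by apply: (pword_mem ps); exact: rank_ltn.
have surj : surjection (unword s) by move=> y; eexists; exact: unword_idx.
split=> // y1 y2 lty.
suff minE y : rank (fibre_min (unword s) y) = index (rank y) s.
  by rewrite -lt_rank !minE; apply: (pword_index ps); rewrite lt_rank lty rank_ltn.
suff -> : fibre_min (unword s) y = unrank S (index (rank y) s).
  by rewrite unrankK.
apply: fibre_min_unique => // x /(congr1 (@rank _ _)).
rewrite leNgt -lt_rank unrankK //.
have szx : rank x < size s by rewrite sz_s rank_ltn.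
rewrite /unword unrankK; last exact: (allP (pword_ltn ps) _ (mem_nth 0 szx)).
by move=> nthx; apply/negP => /(before_find 0)/=; rewrite nthx eqxx.
Qed.
End RigidWords.

Lemma comp_unword d1 d2 d3 (S : finTBOrderType d1) (T : finTBOrderType d2)
    (U : finTBOrderType d3) (f : T -> U) (s : seq nat) (x : S) :
    all (gtn #|T|) s -> size s = #|S| ->
  f (unword T s x) = unword U (map (nth 0 (word f)) s) x.
Proof.
move=> Ts sz_s; have ltx : rank x < size s by rewrite sz_s rank_ltn.
have ltT : nth 0 s (rank x) < #|T| := allP Ts _ (mem_nth 0 ltx).
by rewrite /unword (nth_map 0) // nth_word // rankK.
Qed.

(** * Homomorphisms and rigid extensions *)

(* The canonical order of an ordinal and its bounds, joined in one structure. *)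
HB.instance Definition _ (n : nat) := Order.Total.on 'I_n.+1.

Lemma eval_homomorphism (L : language) (S T : algebra L) (h : S -> T)
    (v : nat -> S) (t : term L) :
  homomorphism (@op L S) (@op L T) h -> h (eval v t) = eval (h \o v) t.
Proof.
move=> h_hom; move: t; fix IH 1; case=> [n | s args] /=; first reflexivity.
by rewrite h_hom; congr op; apply/ffunP => i; rewrite !ffunE; apply: IH.
Qed.

(** A variety is closed under subalgebras of products; in this form no product
    has to be constructed. *)
Lemma variety_separated (L : language) (V : algebra L -> Prop) (I : Type)
    (S : algebra L) (T : I -> algebra L) (h : forall i, S -> T i) :
    is_variety V -> (forall i, V (T i)) ->
    (forall i, homomorphism (@op L S) (@op L (T i)) (h i)) ->
    (forall x y, (forall i, h i x = h i y) -> x = y) ->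
  V S.
Proof.
move=> [E VE] VT h_hom h_inj; apply/VE => e Ee v; apply: h_inj => i.
by rewrite !eval_homomorphism //; apply: (VE (T i)).1.
Qed.

Definition initial_embedding d d' (X : finTBOrderType d)
    (Z : finTBOrderType d') (x : X -> Z) : Prop :=
  {homo x : i j / (i < j)%O} /\
  forall z i, (z <= x i)%O -> exists j, z = x j.

(** Every fibre of [h] meets the initial segment [x], and therefore has its
    minimum there, so that rigidity of [h] can be tested on [x]. *)
Lemma rigid_extension d d' d'' (X : finTBOrderType d) (Z : finTBOrderType d')
    (T : finTBOrderType d'') (x : X -> Z) (u : X -> T) (h : Z -> T) :
    initial_embedding x -> (forall i, h (x i) = u i) -> rigid_surjection u ->
  rigid_surjection h.
Proof.
move=> [x_lt x_init] hx [u_surj u_rigid].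
have h_surj : surjection h by move=> y; have [i <-] := u_surj y; exists (x i).
have x_le : {homo x : i j / (i <= j)%O}.
  by move=> i j; rewrite le_eqVlt => /predU1P[-> // | /x_lt/ltW].
have minE y : fibre_min h y = x (fibre_min u y).
  apply: fibre_min_unique => // [|z hz]; first by rewrite hx fibre_minP.
  have [zle | /ltW //] := leP z (x (fibre_min u y)).
  have [j zE] := x_init _ _ zle; rewrite zE in hz *.
  by apply: x_le; rewrite -hz hx fibre_min_le.
by split=> // y1 y2 /u_rigid; rewrite !minE; apply: x_lt.
Qed.

(** Puts the generators of an algebra at the bottom of its order: the values of
    [x] are enumerated before all other elements. *)
Lemma ordered_enumeration d (X : finTBOrderType d) (D : finType) (x : X -> D) :
  injective x ->
  exists M (phi : 'I_M.+1 -> D) (psi : D -> 'I_M.+1),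
    [/\ cancel phi psi, cancel psi phi & initial_embedding (psi \o x)].
Proof.
move=> x_inj; pose s1 := map x (Order.enum X).
pose s := s1 ++ [seq z <- enum D | z \notin s1].
have s_uniq : uniq s.
  rewrite cat_uniq map_inj_uniq // Order.enum_uniq filter_uniq ?enum_uniq // andbT.
  by apply/hasPn => z; rewrite mem_filter => /andP[].
have s_all z : z \in s by rewrite mem_cat mem_filter mem_enum andbT orbN.
have x_s1 i : x i \in s1 by rewrite map_f // Order.mem_enum.
have rankE i : index (x i) s = rank i.
  rewrite index_cat x_s1 index_map // -{1}(rankK i) index_uniq //.
    by rewrite -Order.cardT rank_ltn.
  exact: Order.enum_uniq.
have sz_s : 0 < size s by have := s_all (x \bot%O); case: (s).
have ltidx z : index z s < (size s).-1.+1 by rewrite prednK // index_mem.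
exists (size s).-1, (fun i => nth (x \bot%O) s i), (fun z => Ordinal (ltidx z)).
split=> [i | z | ].
- by apply: val_inj; rewrite /= index_uniq // (leq_trans (ltn_ord i)) // prednK.
- by rewrite /= nth_index.
split=> [i j | k i].
  by rewrite -lt_rank ltEord /= !rankE.
rewrite leEord /= rankE => leki.
have ltk : k < #|X| := leq_ltn_trans leki (rank_ltn i).
exists (unrank X k); apply: val_inj => /=.
by rewrite rankE unrankK.
Qed.

(** * Free ordered algebras *)

Section Free.
Variables (L : language) (V : algebra L -> Prop) (A B : ordered_algebra V).
Variables (d : Order.disp_t) (X : finTBOrderType d).

Definition op_pairs : finType :=
  ({ffun {ffun X -> A} -> A} * {ffun {ffun X -> B} -> B})%type.

(** Both components of an element of the free algebra on [X] are operations
    given by the same term, and therefore commute with homomorphisms. The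
    pairs with this property form an algebra that may be larger than the free
    one, but it is finite, it has the same extension property for maps into [A]
    and [B], and its definition involves no terms. *)
Definition natural : pred op_pairs := fun pq =>
  `[< forall f, homomorphism (@oa_op _ _ B) (@oa_op _ _ A) f ->
      forall w : {ffun X -> B}, f (pq.2 w) = pq.1 [ffun i => f (w i)] >].

Definition free := {pq : op_pairs | natural pq}.

Definition free_A (u : X -> A) (z : free) : A := (val z).1 [ffun i => u i].
Definition free_B (w : X -> B) (z : free) : B := (val z).2 [ffun i => w i].

Lemma free_natural f w z :
    homomorphism (@oa_op _ _ B) (@oa_op _ _ A) f ->
  f (free_B w z) = free_A (f \o w) z.
Proof.
move=> f_hom; have /asboolP/(_ f f_hom) -> := valP z.
by congr ((val z).1 _); apply/ffunP => i; rewrite !ffunE.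
Qed.

Lemma free_inj z z' :
    (forall u, free_A u z = free_A u z') ->
    (forall w, free_B w z = free_B w z') -> z = z'.
Proof.
move=> eqA eqB; apply: val_inj; case: z eqA eqB => -[p q] ?.
case: z' => -[p' q'] ?.
rewrite /free_A /free_B /= => eqA eqB; congr pair; apply/ffunP => u.
  by have := eqA u; rewrite ffunK.
by have := eqB u; rewrite ffunK.
Qed.

Definition free_op_val s (z : {ffun 'I_(arity s) -> free}) : op_pairs :=
  ([ffun u => oa_op [ffun i => (val (z i)).1 u]],
   [ffun w => oa_op [ffun i => (val (z i)).2 w]]).

Lemma free_op_natural s (z : {ffun 'I_(arity s) -> free}) :
  natural (free_op_val z).
Proof.
apply/asboolP => f f_hom w; rewrite !ffunE f_hom.
congr oa_op; apply/ffunP => i; rewrite !ffunE.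
by have /asboolP/(_ f f_hom) -> := valP (z i).
Qed.

Definition free_op : operations L free :=
  fun s z => Sub (free_op_val z) (free_op_natural z).

Lemma free_A_hom u : homomorphism free_op (@oa_op _ _ A) (free_A u).
Proof.
by move=> s z; rewrite /free_A /= ffunE; congr oa_op; apply/ffunP => i; rewrite !ffunE.
Qed.

Lemma free_B_hom w : homomorphism free_op (@oa_op _ _ B) (free_B w).
Proof.
by move=> s z; rewrite /free_B /= ffunE; congr oa_op; apply/ffunP => i; rewrite !ffunE.
Qed.

Definition gen_val (x : X) : op_pairs :=
  ([ffun u : {ffun X -> A} => u x], [ffun w : {ffun X -> B} => w x]).

Lemma gen_natural x : natural (gen_val x).
Proof. by apply/asboolP => f _ w; rewrite !ffunE. Qed.

Definition gen x : free := Sub (gen_val x) (gen_natural x).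

Lemma free_A_gen u x : free_A u (gen x) = u x.
Proof. by rewrite /free_A !ffunE. Qed.

Lemma free_B_gen w x : free_B w (gen x) = w x.
Proof. by rewrite /free_B !ffunE. Qed.

Lemma gen_inj : 1 < #|B| -> injective gen.
Proof.
move=> /card_gt1P[b [b' [_ _ neq]]] x y.
move=> /(congr1 (free_B (fun z => if z == x then b else b'))).
rewrite !free_B_gen eqxx; case: eqP => // _ eqb.
by rewrite eqb eqxx in neq.
Qed.
End Free.

(** Transporting the algebra of natural pairs to an ordinal gives it an order in
    which the generators come first. *)
Lemma free_ordered_algebra (L : language) (V : algebra L -> Prop)
    (A B : ordered_algebra V) d (X : finTBOrderType d) :
    is_variety V -> 1 < #|B| ->
  exists Z : ordered_algebra V,
  exists (extA : (X -> A) -> Z -> A) (extB : (X -> B) -> Z -> B),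
  [/\ forall u, rigid_surjection u -> rigid_epimorphism (extA u),
      forall w, rigid_surjection w -> rigid_epimorphism (extB w) &
      forall f w z, rigid_epimorphism f -> f (extB w z) = extA (f \o w) z].
Proof.
move=> varV B_gt1.
have [M [phi [psi [phiK psiK gen_init]]]] :=
  ordered_enumeration (gen_inj (A := A) (X := X) B_gt1).
pose opZ : operations L 'I_M.+1 := fun s z => psi (free_op [ffun i => phi (z i)]).
have homZ d' (T : finTBOrderType d') (opT : operations L T) h :
    homomorphism (@free_op L V A B d X) opT h -> homomorphism opZ opT (h \o phi).
  move=> h_hom s z; rewrite /= psiK h_hom.
  by congr opT; apply/ffunP => i; rewrite !ffunE.
pose T (i : (X -> A) + (X -> B)) : algebra L :=
  if i is inl _ then Algebra (@oa_op _ _ A) (inhabits \bot%O)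
  else Algebra (@oa_op _ _ B) (inhabits \bot%O).
pose h i : 'I_M.+1 -> T i :=
  match i with inl u => free_A u \o phi | inr w => free_B w \o phi end.
have VZ : V (Algebra opZ (inhabits \bot%O)).
  refine (@variety_separated L V _ (Algebra opZ (inhabits \bot%O)) T h varV _ _ _).
  - by case=> ?; apply: oa_in.
  - by case=> u; apply: homZ; [apply: free_A_hom | apply: free_B_hom].
  - move=> x y eqh; apply: (can_inj phiK); apply: free_inj => u.
      exact: (eqh (inl u)).
    exact: (eqh (inr u)).
exists (OrderedAlgebra VZ), (fun u => free_A u \o phi), (fun w => free_B w \o phi).
split=> [u u_rigid | w w_rigid | f w z [f_hom _]] /=.
- split; first exact: (homZ _ _ _ _ (free_A_hom u)).
  apply: rigid_extension gen_init _ u_rigid => i /=.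
  by rewrite psiK free_A_gen.
- split; first exact: (homZ _ _ _ _ (free_B_hom w)).
  apply: rigid_extension gen_init _ w_rigid => i /=.
  by rewrite psiK free_B_gen.
- exact: free_natural.
Qed.

(** * The dual Ramsey property *)

Lemma card_le1 (T : Type) (S : set T) (x : T) :
  (S `<=` [set x])%classic -> (S #<= `I_1)%card.
Proof. by move=> /subset_card_le; rewrite (card_le_eqr card_set1). Qed.

Theorem theorem4p13 (L : language) (V : algebra L -> Prop) :
  is_variety V -> nontrivial V -> dual_Ramsey (ordered_finite_algebras V).
Proof.
move=> varV _ k A B k_ge2; rewrite /= in A B *.
have [B_le1 | B_gt1] := leqP #|B| 1.
  exists B => chi; exists (rigid_id B).
  have [[f0] | nohom] := pselect (inhabited (rigid_hom B A)).
    apply: (@card_le1 _ _ (chi f0)) => _ [_ [f _ <-] <-].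
    congr chi; apply: rigid_hom_inj => /=.
    have [_ [f_surj _]] := svalP f.
    apply: funext => b; have [b0 f0b] := f_surj (sval f0 b).
    by rewrite -f0b; congr (sval f _); apply: (card_le1_eqP B_le1).
  apply: (@card_le1 _ _ (Ordinal (ltnW k_ge2))) => y [? [f _ _] _].
  by case: nohom.
have A_gt0 : 0 < #|A| by apply/card_gt0P; exists \bot%O.
(* The first letter of the word of a rigid surjection is always 0; it serves as
   the one-letter alphabet. *)
have [n Hn] := graham_rothschild #|A|.-1 (ltn0Sn 0) 'I_k #|B|.-1.
pose X : finTBOrderType _ := 'I_n.+1.
have [Z [extA [extB [extA_rigid extB_rigid ext_comp]]]] :=
  free_ordered_algebra A X varV B_gt1.
exists Z => chi.
(* Words that do not define a rigid surjection are never compared, so they may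
   receive any colour. *)
pose col (u : X -> A) : 'I_k :=
  if pselect (rigid_surjection u) is left u_rigid
  then chi (exist _ (extA u) (extA_rigid u u_rigid)) else Ordinal (ltnW k_ge2).
have [g /andP[pg /eqP sz_g] [x gP]] := Hn (fun v => col (unword A (0 :: v))).
have cardX : #|X| = n.+1 by rewrite card_ord.
have pg0 : pword 0 #|B| (0 :: g).
  by rewrite /=; move: pg; rewrite add1n prednK //; exact: ltnW.
have w_rigid : rigid_surjection (unword B (0 :: g) : X -> B).
  by apply: unword_rigid => //; rewrite /= sz_g cardX.
exists (exist _ (extB _) (extB_rigid _ w_rigid)).
apply: (@card_le1 _ _ x) => _ [_ [f _ <-] <-].
have [f_hom f_rigid] := svalP f.
have pf := pword_word f_rigid.
have [f' fE] : exists f', word (sval f) = 0 :: f'.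
  case: (word (sval f)) pf => [|[|y] f'] //=.
    by move=> /eqP A0; move: A_gt0; rewrite -A0.
  by move=> _; exists f'.
have sz_f' : size f' = #|B|.-1 by rewrite -(size_word (sval f)) fE.
have pf' : pword 1 (1 + #|A|.-1) f'.
  by move: pf; rewrite fE /= add1n prednK.
rewrite -(gP f' pf' sz_f').
have fwE : unword A (0 :: subst 1 f' g) = sval f \o unword B (0 :: g) :> (X -> A).
  apply: funext => i /=; rewrite comp_unword; last by rewrite /= sz_g cardX.
    rewrite fE /=; congr (unword _ (_ :: _) _); apply: eq_map => y.
    by rewrite /letter; case: y => //= y; rewrite subn1.
  exact: pword_ltn pg0.
have fw_rigid : rigid_surjection (sval f \o unword B (0 :: g) : X -> A).
  exact: rigid_surjection_comp.
rewrite /col fwE; case: pselect => // u_rigid.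
congr chi; apply: rigid_hom_inj => /=; apply: funext => z /=.
by rewrite ext_comp //; exact: svalP.
Qed.
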